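(* Let $G$ be a graph in $\mathcal{G}_2$ that does not contain two distinct $5$-cycles sharing at least one edge. Then $G$ is $3$-colorable.
   Context: All graphs are finite and simple. A hole is an induced cycle of length at least $4$; an odd hole is a hole of odd length. $\mathcal{G}_2$ is the family of graphs of girth exactly $5$ having no odd holes of length at least $7$ (so every $5$-cycle of such a graph is induced). *)

(* Defs.v *)
From mathcomp Require Import all_boot.

Set Implicit Arguments.
Unset Strict Implicit.
Unset Printing Implicit Defensive.

(* A finite simple graph is a symmetric irreflexive relation e on a finType. *)
Section Graphs.

Variables (T : finType) (e : rel T).

(* A cycle is listed by its vertices in cyclic order, so one cycle has several
   listings (rotations and reversals); all of them have the same cycle_edges. *)
Definition is_cycle (c : seq T) : bool := ucycleb e c && (3 <= size c).

Definition cycle_edges (c : seq T) : {set {set T}} :=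
  [set [set x; next c x] | x in c].

Definition induced_cycle (c : seq T) : Prop :=
  is_cycle c /\
  {in c &, forall x y, e x y -> [set x; y] \in cycle_edges c}.

Definition hole (c : seq T) : Prop := induced_cycle c /\ 4 <= size c.

Definition odd_hole (c : seq T) : Prop := hole c /\ odd (size c).

(* A forest has no girth in this sense (its girth is infinite). *)
Definition has_girth (g : nat) : Prop :=
  (exists2 c, is_cycle c & size c = g) /\
  (forall c, is_cycle c -> g <= size c).

Definition family_G2 : Prop :=
  has_girth 5 /\ ~ (exists2 c, odd_hole c & 7 <= size c).

Definition two_5cycles_sharing_edge : Prop :=
  exists c1 c2 : seq T,
    [/\ is_cycle c1 /\ size c1 = 5,
        is_cycle c2 /\ size c2 = 5,
        cycle_edges c1 != cycle_edges c2
      & cycle_edges c1 :&: cycle_edges c2 != set0].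

Definition colorable (k : nat) : Prop :=
  exists f : T -> 'I_k, forall x y, e x y -> f x != f y.

End Graphs.

(* Main.v *)
Require Import Defs.
From mathcomp Require Import all_boot.
From mathcomp Require Import perm.

(* Take a minimal set A of vertices that is not 3-colorable, and a 5-cycle
   C = c1 ... c5 in A, which exists because a shortest odd closed walk is an
   induced cycle and hence has length 5. A vertex outside C has at most one
   neighbour on C, and by minimality every c_i has a neighbour outside C, while
   no component of A - C attaches to two consecutive vertices of C only.

   Closing an induced path outside C by an arc of C gives a hole that shares an
   edge with C, so it must be even. For paths between neighbours of c_i and c_j
   this pins down parities; combined with the holes through a single c_i they
   show that every path from a neighbour of c_(i-1) to one of c_(i+1) meets a
   neighbour of c_i. Hence each component of A - C attaches to exactly three
   consecutive vertices of C. Two components centred at c_2 and c_4 would close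
   up through c1, c3, c5 to an odd hole containing the edge c5 c1; so all
   centres lie among two consecutive c_i, and some c_j has no neighbour outside
   C, a contradiction. *)

(** * Splitting sequences at marked entries *)

Section SplitSeq.

Variable T : Type.
Implicit Types (a b : pred T) (s : seq T).

Lemma has_split_first a s : has a s ->
  exists p x q, [/\ s = p ++ x :: q, a x & ~~ has a p].
Proof.
move=> /split_find[x p q ax aNp].
by exists p, x, q; rewrite cat_rcons.
Qed.

Lemma has_split_last a s : has a s ->
  exists p x q, [/\ s = p ++ x :: q, a x & ~~ has a q].
Proof.
rewrite -has_rev => /has_split_first[p [x [q [Es ax aNp]]]].
exists (rev q), x, (rev p); rewrite has_rev; split=> //.
by rewrite -(revK s) Es rev_cat rev_cons cat_rcons.
Qed.

(** Cut at the first entry satisfying [b], then at the last entry before it satisfying [a]. Because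
    [b] fails at [x], the two cuts are different entries. This trims a path between two attachment
    sets to one with a clean interior. *)
Lemma trim_seq a b x s : a x -> ~~ b x -> b (last x s) ->
  exists p x' m y q,
    [/\ x :: s = p ++ x' :: m ++ y :: q, a x', b y, ~~ has a m & ~~ has b m].
Proof.
move=> ax nbx bl.
have /has_split_first[[|x0 s1] [y [q [Es yb nb]]]] : has b (x :: s).
- by apply/(has_nthP x); exists (size s) => //=; rewrite -last_nth.
- by case: Es yb => <- _; rewrite (negbTE nbx).
have Ex : x = x0 by case: Es.
have /has_split_last[p [x' [m [Es1 ax' nam]]]] : has a (x0 :: s1).
  by rewrite /= -Ex ax.
exists p, x', m, y, q; split=> //; first by rewrite Es Es1 -catA.
by move: nb; rewrite Es1 has_cat /= !negb_or => /and3P[].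
Qed.

End SplitSeq.

(** * Odd closed walks and induced paths *)

Section Bipartite.

Set Implicit Arguments.
Unset Strict Implicit.

Variables (T : finType) (e : rel T).
Hypothesis e_sym : symmetric e.

(* Two-colour each component by the parity of walks from its root, read off
   in the bipartite double cover. *)
Lemma bipartite_of_no_odd_cycle :
  (forall s, cycle e s -> ~~ odd (size s)) ->
  exists f : T -> bool, forall x y, e x y -> f x != f y.
Proof.
move=> noodd.
pose d : rel (T * bool) := [rel u v | e u.1 v.1 && (u.2 != v.2)].
have d_sym : connect_sym d.
  by apply: sym_connect_sym => u v; rewrite /d /= e_sym eq_sym.
have walk (u v : T * bool) : connect d u v ->
    exists p, [/\ path e u.1 p, last u.1 p = v.1 & odd (size p) = (u.2 != v.2)].
  case/connectP => p; elim: p u => [|w p IH] u /=.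
    by move=> _ ->; exists [::]; split; rewrite ?eqxx.
  case/andP => /andP[euw nuw] /IH{}IH /IH[q [pq lq oq]].
  exists (w.1 :: q); split=> //=; first by rewrite euw.
  by rewrite oq; case: (u.2) (w.2) (v.2) nuw => [] [] [].
(* Such a walk projects to an odd closed walk of [e]; [belast] drops the repeated endpoint so that
   it is listed as a [cycle]. *)
have no x : ~~ connect d (x, false) (x, true).
  apply/negP => /walk[p [pp lp op]].
  have := noodd (belast x p); rewrite size_belast.
  case: (lastP p) pp lp op => [|p' z] //=.
  rewrite belast_rcons last_rcons => pp zx; rewrite /= size_rcons -zx in pp * => op.
  by rewrite op => /(_ pp).
have ecs : connect_sym e by apply: sym_connect_sym.
have lift x y : connect e x y -> exists b, connect d (x, false) (y, b).
  case/connectP => p; elim/last_ind: p y => [|p z IH] y /=.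
    by move=> _ ->; exists false.
  rewrite rcons_path last_rcons => /andP[/IH /(_ erefl)[b cb] ez] ->.
  exists (~~ b); apply: connect_trans cb (connect1 _).
  by rewrite /d /= ez; case: b.
exists (fun x => connect d (root e x, false) (x, false)) => x y exy.
have -> : root e x = root e y by apply/(rootP ecs)/connect1.
set r := root e y.
have [b] : exists b, connect d (r, false) (x, b).
  by apply: lift; rewrite /r -(rootP ecs (connect1 exy)) ecs connect_root.
have step b1 : d (x, b1) (y, ~~ b1) by rewrite /d /= exy; case: b1.
(* The root reaches [(x, b)] and hence [(y, ~~ b)]; reaching both copies of one vertex would
   contradict [no]. *)
case: b => cb; last first.
  rewrite cb; apply/negP => /eqP/esym cy.
  have := no y; rewrite (@connect_trans _ _ (x, false)) //.
    apply: connect_trans (_ : connect d (r, false) (x, false)) => //.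
    by rewrite d_sym.
  exact/connect1/step.
have -> : connect d (r, false) (y, false).
  by apply: connect_trans cb (connect1 (step true)).
apply/negP => /eqP cx; have := no x; rewrite (@connect_trans _ _ (r, false)) //.
by rewrite d_sym cx.
Qed.

End Bipartite.

Section Graph.

Set Implicit Arguments.
Unset Strict Implicit.
Unset Printing Implicit Defensive.

Variables (T : finType) (e : rel T).
Hypotheses (e_sym : symmetric e) (e_irr : irreflexive e).

Implicit Types (x y z c : T) (s p q m : seq T).

Lemma edge_neq x y : e x y -> x != y.
Proof. by apply: contraTneq => ->; rewrite e_irr. Qed.

(** Distinctness is built in, so that [induced_path] forces [uniq]. *)
Definition far x y := (y != x) && ~~ e x y.

Lemma far_sym x y : far x y = far y x.
Proof. by rewrite /far e_sym eq_sym. Qed.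

Fixpoint induced_path s : bool :=
  if s is x :: s1 then
    if s1 is y :: s2 then [&& e x y, all (far x) s2 & induced_path s1] else true
  else true.

(** The pieces overlap in [x], so every consecutive pair lies in one of them and only pairs across
    [x] remain to be checked. *)
Lemma induced_path_cat s x y p :
  induced_path (s ++ x :: y :: p) =
  [&& induced_path (s ++ [:: x]), induced_path (x :: y :: p)
    & allrel far s (y :: p)].
Proof.
elim: s => [|z [|z' s] IH].
- by rewrite /= !andbT.
- rewrite /= /allrel /= !andbT.
  by case: (e z x); case: (all (far x) p); case: (e x y); case: (far z y);
     case: (all (far z) p) => //=; rewrite ?andbF ?andbT.
have consE w : induced_path (z :: z' :: s ++ w) =
    [&& e z z', all (far z) (s ++ w) & induced_path ((z' :: s) ++ w)] by [].
rewrite 2!cat_cons !consE IH !all_cat [allrel _ (z :: _) _]allrel_consl.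
rewrite -[all _ (x :: _)]/(far z x && all (far z) (y :: p)).
rewrite -[all _ [:: x]]/(far z x && true) andbT.
case: (e z z'); case: (all _ s); case: (far z x) => //.
by case: (all _ (y :: p)); rewrite //= !andbF.
Qed.

Lemma induced_path_catl s p : induced_path (s ++ p) -> induced_path s.
Proof.
case: (lastP s) => // s' x; case: p => [|y p]; first by rewrite cats0.
by rewrite cat_rcons induced_path_cat cats1 => /andP[].
Qed.

Lemma induced_path_catr s p : induced_path (s ++ p) -> induced_path p.
Proof.
case: p => [|x [|y p]] //.
by rewrite induced_path_cat => /and3P[].
Qed.

Lemma induced_path_infix p s q : induced_path (p ++ s ++ q) -> induced_path s.
Proof. by move/induced_path_catr/induced_path_catl. Qed.

Lemma induced_path_uniq s : induced_path s -> uniq s.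
Proof.
elim: s => [|x [|y s] IH] // /and3P[exy xs ips].
rewrite cons_uniq IH // andbT inE negb_or edge_neq //=.
by apply/negP => xs'; move/allP: xs => /(_ _ xs'); rewrite /far eqxx.
Qed.

Lemma induced_path_edge s x y : induced_path s -> x \in s -> y \in s -> e x y ->
  exists p q, s = p ++ [:: x, y & q] \/ s = p ++ [:: y, x & q].
Proof.
elim: s => [|z [|z' s] IH] //.
  by rewrite /= !inE => _ /eqP-> /eqP->; rewrite e_irr.
move=> /and3P[ezz' fz ips]; rewrite !(in_cons z).
have near w : e z w -> w \in z' :: s -> w = z'.
  move=> ezw; rewrite inE => /orP[/eqP//|ws].
  by move/allP: fz => /(_ _ ws); rewrite /far ezw andbF.
move=> /predU1P[->|xs] /predU1P[->|ys] exy.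
- by rewrite e_irr in exy.
- by exists [::], s; left; rewrite /= (near y).
- by exists [::], s; right; rewrite /= (near x) // e_sym.
have [p [q E]] := IH ips xs ys exy.
by exists (z :: p), q; case: E => ->; [left | right].
Qed.

(** Induction from the far end: [x] is prepended to an induced path from its successor, jumping to
    the last vertex that equals [x] or is adjacent to it. *)
Lemma path_induced_path x p : path e x p ->
  exists q, [/\ induced_path (x :: q), last x q = last x p
    & {subset x :: q <= x :: p}].
Proof.
elim: p x => [|y p IH] x; first by exists [::]; split.
move=> /= /andP[exy /IH[q [ipq lq sq]]].
have /has_split_last[r [z [t [Es az nt]]]] :
    has (fun z => (z == x) || e x z) (y :: q) by rewrite /= exy orbT orTb.
have ipz : induced_path (z :: t) by move: ipq; rewrite Es => /induced_path_catr.
have lz : last x (z :: t) = last y p.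
  by rewrite -lq -[last y q]/(last x (y :: q)) Es last_cat.
have sz : {subset z :: t <= y :: p}.
  by move=> w wz; apply: sq; rewrite Es mem_cat wz orbT.
case/orP: az => [/eqP Ez|exz].
  exists t; rewrite -Ez; split=> //.
  by move=> w /sz wp; rewrite inE wp orbT.
exists (z :: t); split=> //.
  apply/and3P; split=> //.
  rewrite (@eq_all _ _ (predC (fun z => (z == x) || e x z))) ?all_predC //.
  by move=> w; rewrite /= /far negb_or.
move=> w; rewrite inE => /predU1P[->|/sz wp]; first by rewrite inE eqxx.
by rewrite inE wp orbT.
Qed.

(** The subgraph induced on [B], kept as a relation on all of [T]. Every vertex, even one outside
    [B], is connected to itself, hence the side conditions [B x] below. *)
Definition restr (B : pred T) : rel T := [rel x y | [&& B x, B y & e x y]].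

Lemma connect_restr_sym B : connect_sym (restr B).
Proof.
apply: sym_connect_sym => x y; rewrite /restr /= e_sym.
by case: (B x); case: (B y).
Qed.

Lemma path_restr (B : pred T) x p : path (restr B) x p -> path e x p /\ all B p.
Proof.
elim: p x => //= y p IH x /andP[/and3P[_ By exy] /IH[-> ->]].
by rewrite exy By.
Qed.

Lemma connect_restr_in (B : pred T) x y : B x -> connect (restr B) x y -> B y.
Proof.
move=> Bx /connectP[p /path_restr[_ Bp] ->].
by apply: (@allP _ B (x :: p) _ _ (mem_last x p)); rewrite /= Bx.
Qed.

Lemma connect_induced_path (B : pred T) x y : B x -> connect (restr B) x y ->
  exists q, [/\ induced_path (x :: q), last x q = y & all B (x :: q)].
Proof.
move=> Bx /connectP[p /path_restr[pp Bp] ->].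
have [q [ipq lq sq]] := path_induced_path pp; exists q; split=> //.
apply/allP => w /sq; rewrite inE => /predU1P[->//|wp].
exact: (allP Bp).
Qed.

Lemma walk_connect (B : pred T) s x y : sorted e s -> all B s ->
  x \in s -> y \in s -> connect (restr B) x y.
Proof.
case: s => // z s pzs Bs xs ys.
have from z' s' : path e z' s' -> all B (z' :: s') ->
    {in z' :: s', forall w, connect (restr B) z' w}.
  elim: s' z' => [|z1 s' IH] z' /=; first by move=> _ _ w; rewrite inE => /eqP->.
  move=> /andP[ez pz] /and3P[Bz' Bz1 Bs'] w; rewrite inE => /predU1P[->//|ws].
  apply: (@connect_trans _ _ z1); first by apply: connect1; apply/and3P.
  by apply: IH => //=; rewrite Bz1.
have fromz := from z s pzs Bs.
apply: (@connect_trans _ _ z); last exact: fromz.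
by rewrite connect_restr_sym; apply: fromz.
Qed.

Lemma induced_path_sorted s : induced_path s -> sorted e s.
Proof.
elim: s => [|x [|y s] IH] // /and3P[exy _ /IH ps].
by rewrite /= exy.
Qed.

(** * Edges of listed cycles, and closing induced paths to holes *)

Lemma cycle_edges_rot k s : uniq s -> cycle_edges (rot k s) = cycle_edges s.
Proof.
move=> us; apply/setP => E.
apply/imsetP/imsetP => -[x xs ->]; exists x; rewrite ?next_rot //.
  by rewrite -(mem_rot k).
by rewrite mem_rot.
Qed.

Lemma cycle_edges_consecutive p x y q : uniq (p ++ [:: x, y & q]) ->
  [set x; y] \in cycle_edges (p ++ [:: x, y & q]).
Proof.
move=> us; rewrite -(cycle_edges_rot (size p)) // rot_size_cat.
apply/imsetP; exists x; first by rewrite inE eqxx.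
by rewrite /= eqxx.
Qed.

Lemma cycle_edges_closing x p y : uniq (x :: p ++ [:: y]) ->
  [set y; x] \in cycle_edges (x :: p ++ [:: y]).
Proof.
move=> us; rewrite -(cycle_edges_rot (size (x :: p))) //.
rewrite -cat_cons rot_size_cat; apply: (cycle_edges_consecutive (p := [::])).
by move: us; rewrite -cat_cons uniq_catC.
Qed.

Lemma cycle_edges_sub s x y : [set x; y] \in cycle_edges s -> x \in s.
Proof.
case/imsetP => z zs E.
have : x \in [set z; next s z] by rewrite -E set21.
by rewrite !inE => /orP[]/eqP->; rewrite ?mem_next.
Qed.

(** Every hole below is built this way: [c] sees only the two ends of the path, and the path has no
    chord of its own. *)
Lemma closed_induced_cycle c x n y :
  induced_path (x :: n ++ [:: y]) -> e c x -> e c y -> all (far c) n ->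
  induced_cycle e (c :: x :: n ++ [:: y]).
Proof.
move=> ips ex ey fn.
have us : uniq (c :: x :: n ++ [:: y]).
  rewrite cons_uniq induced_path_uniq // andbT inE mem_cat inE !negb_or.
  rewrite !edge_neq // andbT; apply/negP => cn.
  by move/allP: fn => /(_ _ cn); rewrite /far eqxx.
split.
  rewrite /is_cycle /ucycleb us /= size_cat addn1 !andbT ex /=.
  have /= pn := induced_path_sorted ips.
  rewrite rcons_path pn last_cat /=.
  by rewrite e_sym ey.
have near z : z \in x :: n ++ [:: y] -> e c z ->
    [set c; z] \in cycle_edges (c :: x :: n ++ [:: y]).
  rewrite inE mem_cat inE => /or3P[/eqP->|zn|/eqP->] ecz.
  - exact: (cycle_edges_consecutive (p := [::])).
  - by move/allP: fn => /(_ _ zn); rewrite /far ecz andbF.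
  - by rewrite setUC; apply: (@cycle_edges_closing c (x :: n)).
move=> u v; rewrite !(in_cons c) => /predU1P[->|us'] /predU1P[->|vs'] euv.
- by rewrite e_irr in euv.
- exact: near.
- by rewrite setUC; apply: near; rewrite // e_sym.
have [p [q [E|E]]] := induced_path_edge ips us' vs' euv.
  by rewrite E; apply: (cycle_edges_consecutive (p := c :: p)); rewrite cat_cons -E.
rewrite E setUC.
by apply: (cycle_edges_consecutive (p := c :: p)); rewrite cat_cons -E.
Qed.

(** * Shortening odd closed walks *)

Lemma nonuniq_split s : ~~ uniq s -> exists p x q r, s = p ++ x :: q ++ x :: r.
Proof.
elim: s => // x s IH; rewrite cons_uniq negb_and negbK => /orP[xs|/IH].
  by case/splitPr: xs => q r; exists [::], x, q, r.
by case=> p [y [q [r ->]]]; exists (x :: p), y, q, r.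
Qed.

Lemma cycle_cat x q y t : e x y ->
  cycle e (x :: q ++ y :: t) ->
  cycle e (x :: q ++ [:: y]) /\ cycle e (y :: t ++ [:: x]).
Proof.
move=> exy; rewrite /= -!cats1 -!catA !cat_path /= !andbT.
by case/and3P=> -> /andP[-> ->] ->; rewrite exy [e y x]e_sym exy.
Qed.

Lemma cycle_cat_eq x q t :
  cycle e (x :: q ++ x :: t) -> cycle e (x :: q) /\ cycle e (x :: t).
Proof.
rewrite /= -!cats1 -!catA !cat_path /= !andbT.
by case/and3P=> -> /andP[-> ->] ->.
Qed.

(** Strong induction on the length. A repeated vertex or a chord splits the walk into two shorter
    closed walks whose lengths add up to [size s] or [size s + 2], so one of them is odd. *)
Lemma odd_closed_walk s : cycle e s -> odd (size s) ->
  exists s', [/\ induced_cycle e s', odd (size s') & {subset s' <= s}].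
Proof.
have [k] := ubnP (size s); elim: k s => // k IH s /ltnSE-lek cs os.
have reduce t : cycle e t -> odd (size t) -> size t < size s -> {subset t <= s} ->
    exists s', [/\ induced_cycle e s', odd (size s') & {subset s' <= s}].
  move=> ct ot lt sub; have [s' [i o sub']] := IH t (leq_trans lt lek) ct ot.
  by exists s'; split=> // z /sub' /sub.
have [us|/nonuniq_split[p [x [q [r Es]]]]] := boolP (uniq s); last first.
  have [c1 c2] : cycle e (x :: q) /\ cycle e (x :: r ++ p).
    apply: cycle_cat_eq; move: cs; rewrite -(rot_cycle (size p)) Es rot_size_cat.
    by rewrite cat_cons -catA cat_cons.
  have sz : size s = (size q).+1 + (size (r ++ p)).+1.
    rewrite Es !size_cat /= !size_cat /=.
    by rewrite !addnS !addSn [size p + _]addnC -addnA.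
  have := os; rewrite sz oddD; have [oq _|oq oo] := boolP (odd (size q).+1).
    apply: (reduce _ c1); rewrite /= ?sz //; first by rewrite addnS ltnS leq_addr.
    move=> z; rewrite Es inE => /predU1P[->|zq]; rewrite mem_cat inE ?eqxx ?orbT //.
    by rewrite mem_cat zq !orbT.
  apply: (reduce _ c2); rewrite /= ?sz //; first by rewrite addSn ltnS leq_addl.
  move=> z; rewrite Es inE mem_cat => /or3P[/eqP->|zq|zq]; rewrite mem_cat ?zq // inE.
    by rewrite eqxx orbT.
  by rewrite mem_cat inE zq !orbT.
have [/forallP E|] := boolP [forall x in s, forall y in s,
    e x y ==> ([set x; y] \in cycle_edges s)].
  exists s; split=> //; split; last first.
    move=> x y xs ys exy; move/implyP: (E x) => /(_ xs) /forallP /(_ y).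
    by rewrite ys exy.
  rewrite /is_cycle /ucycleb cs us /=.
  case: (s) cs os => [|x [|y [|z t]]] //=.
  by rewrite e_irr.
case/forall_inPn => x xs /forall_inPn[y ys]; rewrite negb_imply => /andP[exy nE].
have [i t Et] := rot_to xs.
have : y \in x :: t by rewrite -Et mem_rot.
rewrite inE eq_sym (negbTE (edge_neq exy)) /= => yt.
have sub : {subset x :: t <= s} by move=> z; rewrite -Et mem_rot.
move: nE; rewrite -(cycle_edges_rot i) // Et.
have sz : size s = size (x :: t) by rewrite -Et size_rot.
have : cycle e (x :: t) by rewrite -Et rot_cycle.
have : uniq (x :: t) by rewrite -Et rot_uniq.
case/splitPr: yt sub sz => p q sub sz ut ct nE.
(* If [p] or [q] were empty, the chord would be an edge of the cycle; so both closed walks cut off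
   by the chord are strictly shorter. *)
have p0 : 0 < size p.
  case: (p) nE ut => // /negP nE ut; case: nE.
  exact: (cycle_edges_consecutive (p := [::])).
have q0 : 0 < size q.
  case: (q) nE ut => // /negP nE ut; case: nE.
  by rewrite setUC; apply: cycle_edges_closing.
have [c1 c2] := cycle_cat exy ct.
have sz1 : size (x :: p ++ [:: y]) = (size p).+2 by rewrite /= size_cat addn1.
have sz2 : size (y :: q ++ [:: x]) = (size q).+2 by rewrite /= size_cat addn1.
have szs : size s = (size p + size q).+2 by rewrite sz /= size_cat addnS.
have := os; rewrite szs /= negbK oddD; have [op _|op oq] := boolP (odd (size p)).
  apply: (reduce _ c1); rewrite ?sz1 ?szs /= ?negbK //.
    by rewrite !ltnS -addn1 leq_add2l.
  move=> z; rewrite inE mem_cat inE => zz; apply: sub.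
  by rewrite inE mem_cat inE; case/or3P: zz => ->; rewrite ?orbT.
apply: (reduce _ c2); rewrite ?sz2 ?szs /= ?negbK //.
  by rewrite !ltnS -add1n leq_add2r.
move=> z; rewrite inE mem_cat inE => zz; apply: sub.
by rewrite inE mem_cat inE; case/or3P: zz => ->; rewrite ?orbT.
Qed.

(** * Attachments to a 5-cycle *)

Hypothesis G2 : family_G2 e.

Lemma cycle_size_ge5 s : is_cycle e s -> 5 <= size s.
Proof. by case: G2 => -[_ girth] _; apply: girth. Qed.

Lemma no_triangle x y z : e x y -> e y z -> e z x -> False.
Proof.
move=> exy eyz ezx; suff /cycle_size_ge5 : is_cycle e [:: x; y; z] by [].
rewrite /is_cycle /ucycleb /= exy eyz ezx !inE !negb_or !edge_neq //.
by rewrite e_sym.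
Qed.

Lemma no_square x y z w :
  e x y -> e y z -> e z w -> e w x -> x != z -> y != w -> False.
Proof.
move=> exy eyz ezw ewx xz yw.
suff /cycle_size_ge5 : is_cycle e [:: x; y; z; w] by [].
rewrite /is_cycle /ucycleb /= exy eyz ezw ewx !inE !negb_or xz yw.
rewrite !(edge_neq exy, edge_neq eyz, edge_neq ezw) /=.
by rewrite edge_neq // e_sym.
Qed.

(** Girth rules out lengths below 5, the family rules out odd holes from 7 on, and 6 is even. *)
Lemma odd_induced_cycle_size s : induced_cycle e s -> odd (size s) -> size s = 5.
Proof.
move=> is_ os; have s5 := cycle_size_ge5 (proj1 is_).
case: G2 => _ no7; apply/eqP; rewrite eqn_leq s5 andbT leqNgt; apply/negP => s6.
case: no7; exists s.
  by split=> //; split=> //; apply: leq_trans s5.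
by rewrite ltn_neqAle s6 andbT; apply: contraTneq os => <-.
Qed.

Hypothesis no_shared : ~ two_5cycles_sharing_edge e.

(* c1, ..., c5 lists C in cyclic order; every symmetry of the 5-cycle is then a
   relabelling. *)
Definition pentagon (C : {set T}) c1 c2 c3 c4 c5 : bool :=
  [&& C == [set:: [:: c1; c2; c3; c4; c5]], uniq [:: c1; c2; c3; c4; c5]
    & cycle e [:: c1; c2; c3; c4; c5]].

Section Pentagon.

Variable C : {set T}.

Lemma pentagon_rot c1 c2 c3 c4 c5 :
  pentagon C c1 c2 c3 c4 c5 -> pentagon C c2 c3 c4 c5 c1.
Proof.
have E : [:: c2; c3; c4; c5; c1] = rot 1 [:: c1; c2; c3; c4; c5] by [].
case/and3P => /eqP-> us cs; apply/and3P; split; rewrite E ?rot_uniq ?rot_cycle //.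
by apply/eqP/setP => x; rewrite !in_set mem_rot.
Qed.

Lemma pentagon_rev c1 c2 c3 c4 c5 :
  pentagon C c1 c2 c3 c4 c5 -> pentagon C c5 c4 c3 c2 c1.
Proof.
have E : [:: c5; c4; c3; c2; c1] = rev [:: c1; c2; c3; c4; c5] by [].
case/and3P => /eqP-> us cs; apply/and3P; split; rewrite E ?rev_uniq ?rev_cycle //.
  by apply/eqP/setP => x; rewrite !in_set mem_rev.
by rewrite (eq_cycle (e' := e)) // => x y; rewrite e_sym.
Qed.

Lemma pentagon_flip c1 c2 c3 c4 c5 :
  pentagon C c1 c2 c3 c4 c5 -> pentagon C c1 c5 c4 c3 c2.
Proof. by move=> P; do 4!apply: pentagon_rot; apply: pentagon_rev. Qed.

Lemma mem_pentagon c1 c2 c3 c4 c5 : pentagon C c1 c2 c3 c4 c5 ->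
  C =i [:: c1; c2; c3; c4; c5].
Proof. by case/and3P => /eqP-> _ _ x; rewrite inE. Qed.

Lemma pentagon_edge c1 c2 c3 c4 c5 : pentagon C c1 c2 c3 c4 c5 -> e c1 c2.
Proof. by case/and3P => _ _ /andP[]. Qed.

Lemma pentagon_far c1 c2 c3 c4 c5 : pentagon C c1 c2 c3 c4 c5 -> far c1 c3.
Proof.
move=> P; have e12 := pentagon_edge P.
have e23 := pentagon_edge (pentagon_rot P).
apply/andP; split; last first.
  by apply/negP => e13; apply: (no_triangle e12 e23); rewrite e_sym.
case/and3P: P => _ /andP[]; rewrite !inE !negb_or.
by case/and4P => _ c13 _ _ _ _; rewrite eq_sym.
Qed.

Lemma pentagon_hd c1 c2 c3 c4 c5 : pentagon C c1 c2 c3 c4 c5 -> c1 \in C.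
Proof. by move/mem_pentagon->; rewrite inE eqxx. Qed.

Lemma pentagon_from c1 c2 c3 c4 c5 c : pentagon C c1 c2 c3 c4 c5 -> c \in C ->
  exists d2 d3 d4 d5, pentagon C c d2 d3 d4 d5.
Proof.
move=> P; rewrite (mem_pentagon P) !inE.
case/or4P => [| | |/orP[]] /eqP->.
- by exists c2, c3, c4, c5.
- by exists c3, c4, c5, c1; apply: pentagon_rot.
- by exists c4, c5, c1, c2; do 2!apply: pentagon_rot.
- by exists c5, c1, c2, c3; do 3!apply: pentagon_rot.
- by exists c1, c2, c3, c4; do 4!apply: pentagon_rot.
Qed.

(** Two neighbours on [C] would close a triangle if adjacent and a square if at distance two. *)
Lemma unique_attachment c1 c2 c3 c4 c5 c d v : pentagon C c1 c2 c3 c4 c5 ->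
  v \notin C -> c \in C -> d \in C -> c != d -> e c v -> ~~ e d v.
Proof.
move=> P0 vC /(pentagon_from P0)[d2 [d3 [d4 [d5 P]]]] dC cd ecv {P0 c1 c2 c3 c4 c5}.
have vN x : x \in C -> v != x by apply: contraTneq => <-.
apply/negP; rewrite e_sym => evd.
have adj a b b1 b2 b3 : pentagon C c a b b1 b2 -> b3 = a -> e v b3 -> False.
  move=> Q -> eva; apply: (no_triangle ecv eva).
  by rewrite e_sym (pentagon_edge Q).
have dist a b b1 b2 b3 : pentagon C c a b b1 b2 -> b3 = b -> e v b3 -> False.
  move=> Q -> evb; have /andP[bc _] := pentagon_far Q.
  apply: (@no_square c v b a) => //.
  - by rewrite e_sym (pentagon_edge (pentagon_rot Q)).
  - by rewrite e_sym (pentagon_edge Q).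
  - by rewrite eq_sym.
  - exact/vN/(pentagon_hd (pentagon_rot Q)).
move: dC evd cd; rewrite (mem_pentagon P) !inE.
have Q := pentagon_flip P.
case/or4P => [/eqP->|/eqP E|/eqP E|/orP[]/eqP E] evd; rewrite ?eqxx // => _.
- exact: adj P E evd.
- exact: dist P E evd.
- exact: dist Q E evd.
- exact: adj Q E evd.
Qed.

(** Every vertex of [s] lies on an edge of [s], so the vertex [w] off [C] makes the edge sets
    differ, while the edge [c1 c2] is common. *)
Lemma no_second_pentagon c1 c2 c3 c4 c5 s w : pentagon C c1 c2 c3 c4 c5 ->
  is_cycle e s -> size s = 5 -> [set c1; c2] \in cycle_edges s ->
  w \in s -> w \notin C -> False.
Proof.
move=> P cs s5 Es ws wC; case: no_shared.
have us : uniq [:: c1; c2; c3; c4; c5] by case/and3P: P.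
exists [:: c1; c2; c3; c4; c5], s; split=> //.
- by split=> //; rewrite /is_cycle /ucycleb us andbT; case/and3P: P => _ _ ->.
- apply: contraNneq wC => E; rewrite (mem_pentagon P).
  have : [set w; next s w] \in cycle_edges s by apply/imsetP; exists w.
  by rewrite -E => /cycle_edges_sub.
- apply/set0Pn; exists [set c1; c2]; rewrite inE Es andbT.
  exact: (cycle_edges_consecutive (p := [::])).
Qed.

(** The hole [c1, x, n, c2] has length [size n + 3]. Were that odd it would be 5, giving a second
    5-cycle through the edge [c1 c2]. *)
Lemma odd_hole_through_edge c1 c2 c3 c4 c5 x n w : pentagon C c1 c2 c3 c4 c5 ->
  induced_path (x :: n ++ [:: c2]) -> e c1 x -> all (far c1) n ->
  w \in x :: n -> w \notin C -> odd (size n).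
Proof.
move=> P ips ex fn wn wC; apply/negPn/negP => on.
have ic := closed_induced_cycle ips ex (pentagon_edge P) fn.
apply: (no_second_pentagon P (proj1 ic) (w := w)) => //.
- by apply: odd_induced_cycle_size; rewrite //= size_cat addn1 /= negbK.
- rewrite setUC; apply: (cycle_edges_closing (p := x :: n)).
  by case: ic => /andP[/andP[]].
- by rewrite inE -cat_cons mem_cat wn orbT.
Qed.

Lemma induced_path_rcons s y c : induced_path (s ++ [:: y]) -> e y c ->
  all (far c) s -> induced_path (s ++ [:: y; c]).
Proof.
move=> ips eyc fs; rewrite induced_path_cat ips /= eyc /=.
by apply/allrelP => u v us; rewrite inE => /eqP->; rewrite far_sym (allP fs).
Qed.

Lemma far_outside c s : c \in C -> all [predC C] s -> ~~ has (e c) s ->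
  all (far c) s.
Proof.
move=> cC out /hasPn fs; apply/allP => v vs; rewrite /far fs // andbT.
by apply: contraTneq cC => <-; apply: (allP out).
Qed.


Lemma hasN_cat (a : pred T) s s' : ~~ has a (s ++ s') = ~~ has a s && ~~ has a s'.
Proof. by rewrite has_cat negb_or. Qed.

Lemma hasN_cons (a : pred T) x s : ~~ has a (x :: s) = ~~ a x && ~~ has a s.
Proof. by rewrite /= negb_or. Qed.

Lemma all_consE (a : pred T) x s : all a (x :: s) = a x && all a s.
Proof. by []. Qed.

(** Attachment conditions are stated on whole paths and used on pieces; these tactics distribute
    them over concatenations. *)
Ltac split_in H :=
  rewrite ?(hasN_cat, hasN_cons, all_cat, all_consE) -?andbA /= in H.
Ltac split_along :=
  repeat match goal with
  | H : is_true (all _ (_ ++ _)) |- _ => rewrite all_cat in H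
  | H : is_true (all _ (_ :: _)) |- _ => rewrite all_consE in H
  | H : is_true (~~ has _ (_ ++ _)) |- _ => rewrite hasN_cat in H
  | H : is_true (~~ has _ (_ :: _)) |- _ => rewrite hasN_cons in H
  | H : is_true (_ && _) |- _ =>
      let H1 := fresh in let H2 := fresh in case/andP: H => H1 H2
  end;
  rewrite ?(hasN_cat, hasN_cons, all_cat, all_consE);
  repeat (apply/andP; split) => //.

(** * Parity of induced paths between attachments *)

(** The edge [c2 c1] closes the path to a hole of length [size m + 4]. *)
Lemma even_path12 c1 c2 c3 c4 c5 x m y : pentagon C c1 c2 c3 c4 c5 ->
  induced_path (x :: m ++ [:: y]) -> all [predC C] (x :: m ++ [:: y]) ->
  e c1 x -> e c2 y -> ~~ has (e c1) m -> ~~ has (e c2) m -> ~~ odd (size m).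
Proof.
move=> P ips out e1x e2y f1 f2.
have [C1 C2] := (pentagon_hd P, pentagon_hd (pentagon_rot P)).
have c12 := edge_neq (pentagon_edge P).
have out' := out; split_in out'; case/and4P: out' => xC mC yC _.
suff : odd (size (m ++ [:: y])) by rewrite size_cat addn1.
apply: (odd_hole_through_edge P (x := x) (w := x)) => //; last 2 first.
- apply: far_outside => //; split_along.
  by rewrite (unique_attachment P yC C2) // eq_sym.
- by rewrite inE eqxx.
rewrite -catA; apply: (induced_path_rcons (s := x :: m)) => //; first by rewrite e_sym.
by apply: far_outside => //; split_along; rewrite (unique_attachment P xC C1).
Qed.

Lemma induced_path_ends c d x m y : c \in C -> d \in C ->
  induced_path (x :: m ++ [:: y]) -> all [predC C] (x :: m ++ [:: y]) ->
  e c x -> e d y -> far c d -> ~~ has (e c) (m ++ [:: y]) -> ~~ has (e d) (x :: m) ->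
  induced_path (c :: x :: m ++ [:: y; d]).
Proof.
move=> cC dC ips out ecx edy fcd fc fd; apply/and3P; split=> //.
  rewrite -cat1s catA all_cat /= fcd far_outside //.
  by split_along.
apply: (induced_path_rcons (s := x :: m)) => //; first by rewrite e_sym.
by apply: far_outside => //; split_along.
Qed.

(** The arc [c3 c2 c1] closes the path to a hole of length [size m + 5]. *)
Lemma odd_path13 c1 c2 c3 c4 c5 x m y : pentagon C c1 c2 c3 c4 c5 ->
  induced_path (x :: m ++ [:: y]) -> all [predC C] (x :: m ++ [:: y]) ->
  e c1 x -> e c3 y -> ~~ has (e c1) m -> ~~ has (e c2) m -> ~~ has (e c3) m ->
  odd (size m).
Proof.
move=> P ips out e1x e3y f1 f2 f3.
have P2 := pentagon_rot P; have P3 := pentagon_rot P2.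
have [C1 C2 C3] := And3 (pentagon_hd P) (pentagon_hd P2) (pentagon_hd P3).
have f13 := pentagon_far P; have /andP[c31 _] := f13.
have c12 := edge_neq (pentagon_edge P); have c23 := edge_neq (pentagon_edge P2).
have out' := out; split_in out'; case/and4P: out' => xC mC yC _.
suff : odd (size (x :: m ++ [:: y])) by rewrite /= size_cat addn1 /= negbK.
apply: (odd_hole_through_edge P2 (x := c1) (w := x)) => //.
- rewrite cat_cons -catA; apply: induced_path_ends => //; split_along.
    by rewrite (unique_attachment P yC C3).
  by rewrite (unique_attachment P xC C1) // eq_sym.
- by rewrite e_sym (pentagon_edge P).
- apply: far_outside => //; split_along; first by rewrite (unique_attachment P xC C1).
  by rewrite (unique_attachment P yC C3) // eq_sym.
- by rewrite !inE eqxx orbT.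
Qed.

(** The other arc [c3 c4 c5 c1] closes the path to a hole of length [size m + 6]. *)
Lemma even_path13 c1 c2 c3 c4 c5 x m y : pentagon C c1 c2 c3 c4 c5 ->
  induced_path (x :: m ++ [:: y]) -> all [predC C] (x :: m ++ [:: y]) ->
  e c1 x -> e c3 y -> ~~ has (e c1) m -> ~~ has (e c3) m -> ~~ has (e c4) m ->
  ~~ has (e c5) m -> ~~ odd (size m).
Proof.
move=> P ips out e1x e3y f1 f3 f4 f5.
have P3 := pentagon_rot (pentagon_rot P).
have P4 := pentagon_rot P3; have P5 := pentagon_rot P4.
have [C1 C3] := (pentagon_hd P, pentagon_hd P3).
have [C4 C5] := (pentagon_hd P4, pentagon_hd P5).
have f13 := pentagon_far P; have /andP[c31 _] := f13.
have f41 := pentagon_far P4; have /andP[c14 _] := f41.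
have f35 := pentagon_far P3; have /andP[c53 _] := f35.
have c34 := edge_neq (pentagon_edge P3); have c51 := edge_neq (pentagon_edge P5).
have out' := out; split_in out'; case/and4P: out' => xC mC yC _.
have x3 : ~~ e c3 x by rewrite (unique_attachment P xC C1) // eq_sym.
have x4 : ~~ e c4 x by rewrite (unique_attachment P xC C1).
have x5 : ~~ e c5 x by rewrite (unique_attachment P xC C1) // eq_sym.
have y1 : ~~ e c1 y by rewrite (unique_attachment P yC C3).
have y4 : ~~ e c4 y by rewrite (unique_attachment P yC C3).
have y5 : ~~ e c5 y by rewrite (unique_attachment P yC C3) // eq_sym.
suff : odd (size (x :: m ++ [:: y; c3])) by rewrite /= size_cat addn2 /= negbK.
have Q5 := pentagon_rev P.
apply: (odd_hole_through_edge Q5 (x := c1) (w := x)) => //.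
- have -> : c1 :: (x :: m ++ [:: y; c3]) ++ [:: c4] =
      (c1 :: x :: m ++ [:: y]) ++ [:: c3; c4] by rewrite /= -!catA.
  apply: induced_path_rcons.
  + rewrite 2!cat_cons -catA; apply: induced_path_ends => //; split_along.
  + by rewrite (pentagon_edge P3).
  + by rewrite all_consE f41; apply: far_outside => //; split_along.
- by rewrite (pentagon_edge P5).
- have -> : x :: m ++ [:: y; c3] = (x :: m ++ [:: y]) ++ [:: c3] by rewrite /= -catA.
  rewrite all_cat; apply/andP; split; last by rewrite /= far_sym f35.
  by apply: far_outside => //; split_along.
- by rewrite !inE eqxx orbT.
Qed.

(** The two arcs between [c1] and [c3] have lengths of opposite parity, and both would close the
    path to a hole. *)
Lemma no_direct_path13 c1 c2 c3 c4 c5 x m y : pentagon C c1 c2 c3 c4 c5 ->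
  induced_path (x :: m ++ [:: y]) -> all [predC C] (x :: m ++ [:: y]) ->
  e c1 x -> e c3 y -> ~~ has (e c1) m -> ~~ has (e c2) m -> ~~ has (e c3) m ->
  ~~ has (e c4) m -> ~~ has (e c5) m -> False.
Proof.
move=> P ips out e1x e3y f1 f2 f3 f4 f5.
have := even_path13 P ips out e1x e3y f1 f3 f4 f5.
by rewrite (odd_path13 P ips out e1x e3y f1 f2 f3).
Qed.

(** The hole through [c2] alone has length [size m + 3]. It need not share an edge with [C], so
    length 5 is excluded separately, by the neighbour of [c3]. *)
Lemma odd_path22 c1 c2 c3 c4 c5 x m y : pentagon C c1 c2 c3 c4 c5 ->
  induced_path (x :: m ++ [:: y]) -> all [predC C] (x :: m ++ [:: y]) ->
  e c2 x -> e c2 y -> ~~ has (e c2) m -> has (e c3) m -> odd (size m).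
Proof.
move=> P ips out e2x e2y f2 h3.
have P2 := pentagon_rot P; have P3 := pentagon_rot P2.
have [C2 C3] := (pentagon_hd P2, pentagon_hd P3).
have c23 := edge_neq (pentagon_edge P2).
have out' := out; split_in out'; case/and4P: out' => xC mC yC _.
apply/negPn/negP => om.
have ic : induced_cycle e (c2 :: x :: m ++ [:: y]).
  by apply: closed_induced_cycle => //; apply: far_outside.
have := odd_induced_cycle_size ic; rewrite /= size_cat addn1 /= negbK => /(_ om) [].
(* When [m] has two vertices, the one adjacent to [c3] is next to an end of the path, which is
   adjacent to [c2]: a square on the edge [c2 c3]. *)
have no z w : z \notin C -> w \notin C -> e c2 z -> e c3 w -> e z w -> False.
  move=> zC wC ez ew ezw; apply: (@no_square c2 z w c3) => //.
  - by rewrite e_sym.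
  - by rewrite e_sym (pentagon_edge P2).
  - by apply: contraNneq wC => <-.
  - by apply: contraNneq zC => ->.
case: m ips mC f2 h3 {om ic out} => [|u [|v [|//]]] //= ips.
rewrite !andbT orbF => /andP[uC vC] _ /orP[h|h] _.
  by case/and3P: ips => exu _ _; apply: (no x u).
rewrite orbF in h; case/and5P: ips => _ _ _ _ /andP[evy _].
by apply: (no y v); rewrite // e_sym.
Qed.

(* Along an induced path leaving a neighbour of c1 and missing those of c4 and
   c5, the neighbours of c2 that end a crossing between c2 and c3 occur at even
   positions and those of c3 at odd positions: a detour c3 - c2 - ... - c2 - c3
   returns at the same parity, since it closes to an even hole through c3. *)
Lemma crossing_parity c1 c2 c3 c4 c5 x0 t : pentagon C c1 c2 c3 c4 c5 ->
  induced_path (x0 :: t) -> all [predC C] (x0 :: t) -> e c1 x0 ->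
  ~~ has (e c1) t -> ~~ has (e c4) t -> ~~ has (e c5) t ->
  forall p x m y q, x0 :: t = p ++ x :: m ++ y :: q ->
  ~~ has (e c2) m -> ~~ has (e c3) m ->
  (e c2 x -> e c3 y -> ~~ odd (size p)) /\ (e c3 x -> e c2 y -> odd (size p)).
Proof.
move=> P; have P2 := pentagon_rot P; have P3 := pentagon_rot P2.
(* In this relabelling [c2] and [c3] exchange roles. *)
have R : pentagon C c4 c3 c2 c1 c5 by apply/pentagon_rot/pentagon_rev.
have R2 := pentagon_rot R.
have [C1 C2 C3] := And3 (pentagon_hd P) (pentagon_hd P2) (pentagon_hd P3).
have c12 := edge_neq (pentagon_edge P); have c23 := edge_neq (pentagon_edge P2).
have /andP[c31 _] := pentagon_far P.
move=> ips0 out0 e1x0 f1 f4 f5 p x m y q E m2 m3.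
have [k] := ubnP (size p); elim: k => // k IH in p x m y q E m2 m3 *; move=> /ltnSE-lek.
have x0C : x0 \notin C by case/andP: out0.
have x02 : ~~ e c2 x0 by rewrite (unique_attachment P x0C C1).
have x03 : ~~ e c3 x0 by rewrite (unique_attachment P x0C C1) // eq_sym.
case: p E lek => [[<- _] _|x0' p [E1 E] lek].
  by split=> [e2x|e3x]; [rewrite e2x in x02 | rewrite e3x in x03].
subst x0' t; split_along.
have ipm : induced_path (x :: m ++ [:: y]).
  apply: (induced_path_infix (p := x0 :: p) (q := q)).
  by rewrite /= -catA.
split=> [e2x e3y|e3x e2y].
  have em : ~~ odd (size m).
    by apply: (even_path12 P2 ipm) => //; split_along.
  have x3 : ~~ e c3 x by apply: (unique_attachment P2 _ C2 C3 c23).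
  (* From the last neighbour [w] of [c3] before [x], the path crosses to [c2] first at [x'].
     Induction makes the position of [w] odd, and the detour from [w] to [y] fixes the position of
     [x] relative to it. *)
  have [/has_split_last[p1 [w [p2 [Ep e3w p23]]]]|p3] := boolP (has (e c3) p).
    subst p; split_along.
    have : has (e c2) (p2 ++ [:: x]) by rewrite has_cat /= e2x orbT.
    case/has_split_first => m' [x' [r [Em' e2x' m'2]]].
    have m'3 : ~~ has (e c3) m'.
      have : ~~ has (e c3) (p2 ++ [:: x]) by split_along.
      by rewrite Em' hasN_cat => /andP[].
    have E : x0 :: (p1 ++ w :: p2) ++ x :: m ++ y :: q =
        (x0 :: p1) ++ w :: m' ++ x' :: (r ++ m ++ y :: q).
      by rewrite /= -catA /= -[x :: _ ++ _]cat1s catA Em' -catA.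
    have [] := IH _ _ _ _ _ E m'2 m'3.
      by apply: leq_trans lek; rewrite /= size_cat /= addnS ltnS leq_addr.
    move=> _ /(_ e3w e2x') op1.
    have : odd (size (p2 ++ x :: m)).
      apply: (odd_path22 (x := w) (y := y) R) => //.
      - apply: (induced_path_infix (p := x0 :: p1) (q := q)).
        by move: ips0; rewrite /= -?catA /= -?catA.
      - by split_along.
      - by split_along.
      - by rewrite has_cat /= e2x orbT.
    move: op1 em; rewrite /= !size_cat /= !oddD /= ?oddD.
    by do 3!case: (odd _).
  (* With no earlier neighbour of [c3], the stretch from [x0] to [y] runs from [c1] to [c3] and
     closes along [c4] and [c5]. *)
  have : ~~ odd (size (p ++ x :: m)).
    apply: (even_path13 (x := x0) (y := y) P) => //; try by split_along.
    apply: (induced_path_infix (p := [::]) (q := q)).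
    by move: ips0; rewrite /= -?catA /= -?catA.
  move: em; rewrite size_cat /= !oddD /=.
  by do 2!case: (odd _).
have em : ~~ odd (size m).
  by apply: (even_path12 (pentagon_rot R) ipm) => //; split_along.
have x2 : ~~ e c2 x by apply: (unique_attachment P2 _ C3 C2); rewrite // eq_sym.
have [/has_split_last[p1 [w [p2 [Ep e2w p22]]]]|p2] := boolP (has (e c2) p).
  subst p; split_along.
  have : has (e c3) (p2 ++ [:: x]) by rewrite has_cat /= e3x orbT.
  case/has_split_first => m' [x' [r [Em' e3x' m'3]]].
  have m'2 : ~~ has (e c2) m'.
    have : ~~ has (e c2) (p2 ++ [:: x]) by split_along.
    by rewrite Em' hasN_cat => /andP[].
  have E : x0 :: (p1 ++ w :: p2) ++ x :: m ++ y :: q =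
      (x0 :: p1) ++ w :: m' ++ x' :: (r ++ m ++ y :: q).
    by rewrite /= -catA /= -[x :: _ ++ _]cat1s catA Em' -catA.
  have [] := IH _ _ _ _ _ E m'2 m'3.
    by apply: leq_trans lek; rewrite /= size_cat /= addnS ltnS leq_addr.
  move=> /(_ e2w e3x') op1 _.
  have : odd (size (p2 ++ x :: m)).
    apply: (odd_path22 (x := w) (y := y) P) => //.
    - apply: (induced_path_infix (p := x0 :: p1) (q := q)).
      by move: ips0; rewrite /= -?catA /= -?catA.
    - by split_along.
    - by split_along.
    - by rewrite has_cat /= e3x orbT.
  move: op1 em; rewrite /= !size_cat /= !oddD /= ?oddD.
  by do 3!case: (odd _).
(* With no neighbour of [c2] before [x], the stretch up to the first neighbour of [c3] is a direct
   path from [c1] to [c3]. *)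
have /has_split_first[m' [x' [r [Em' e3x' m'3]]]] : has (e c3) (p ++ [:: x]).
  by rewrite has_cat /= e3x orbT.
have sub (a : pred T) : ~~ has a p -> ~~ a x -> ~~ has a m'.
  move=> ap ax; have : ~~ has a (p ++ [:: x]) by split_along.
  by rewrite Em' hasN_cat => /andP[].
case: (no_direct_path13 (x := x0) (m := m') (y := x') P) => //; try exact: sub.
- apply: (induced_path_infix (p := [::]) (q := r ++ m ++ y :: q)).
  by move: ips0; rewrite /= -[x :: _ ++ _]cat1s catA Em' -!catA.
- have : all [predC C] (p ++ [:: x]) by split_along.
  by rewrite Em' => outm; split_along.
Qed.

(** Closing along [c5] makes [size m] odd. If the path avoids a crossing from [c2] to [c3], some
    stretch of it is a direct path. Otherwise the last neighbour [z] of [c2] sits at an even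
    position and the stretch from [z] to [y] has even interior, which makes [size m] even. *)
Lemma no_induced_path14 c1 c2 c3 c4 c5 x m y : pentagon C c1 c2 c3 c4 c5 ->
  induced_path (x :: m ++ [:: y]) -> all [predC C] (x :: m ++ [:: y]) ->
  e c1 x -> e c4 y -> ~~ has (e c1) m -> ~~ has (e c4) m -> ~~ has (e c5) m ->
  False.
Proof.
move=> P ips out e1x e4y f1 f4 f5.
have P2 := pentagon_rot P; have F := pentagon_flip P.
have [C1 C2] := (pentagon_hd P, pentagon_hd P2).
have c12 := edge_neq (pentagon_edge P).
have om : odd (size m) by apply: (odd_path13 F ips).
have xC : x \notin C by case/andP: out.
have x2 : ~~ e c2 x by rewrite (unique_attachment P xC C1).
have [|f2] := boolP (has (e c2) m); last first.
  have [|f3] := boolP (has (e c3) m); last by apply: (no_direct_path13 F ips).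
  case/has_split_first => p [z [q [Em e3z p3]]]; subst m; split_along.
  apply: (no_direct_path13 (x := x) (m := p) (y := z) P) => //; last by split_along.
  apply: (induced_path_infix (p := [::]) (q := q ++ [:: y])).
  by move: ips; rewrite /= -?catA.
case/has_split_last => p [z [r [Em e2z r2]]]; subst m; split_along.
have ipr : induced_path (z :: r ++ [:: y]).
  apply: (induced_path_infix (p := x :: p) (q := [::])).
  by move: ips; rewrite /= cats0 -?catA.
have [|r3] := boolP (has (e c3) r); last first.
  by apply: (no_direct_path13 P2 ipr) => //; split_along.
case/has_split_first => m [w [q [Er e3w m3]]]; subst r; split_along.
(* The end [y] is cut off because [crossing_parity] wants no neighbour of [c4] after the start. *)
have ip0 : induced_path (x :: p ++ z :: m ++ w :: q).
  apply: (induced_path_infix (p := [::]) (q := [:: y])).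
  by move: ips; rewrite /= -?catA /= -?catA.
have [||||||/(_ e2z e3w) ep _] := crossing_parity (t := p ++ z :: m ++ w :: q)
  P ip0 _ e1x _ _ _ (p := x :: p) (x := z) (m := m) (y := w) (q := q) erefl;
  try by split_along.
have er : ~~ odd (size (m ++ w :: q)).
  by apply: (even_path13 P2 ipr) => //; split_along.
move: om ep er; rewrite /= size_cat /= oddD /=.
by do 2!case: (odd _).
Qed.

Lemma induced_path_between c1 c2 c3 c4 c5 c d s : pentagon C c1 c2 c3 c4 c5 ->
  c \in C -> d \in C -> c != d ->
  sorted e s -> all [predC C] s -> has (e c) s -> has (e d) s ->
  exists x m y, [/\ induced_path (x :: m ++ [:: y]),
    {subset x :: m ++ [:: y] <= s}, e c x /\ e d y, ~~ has (e c) m & ~~ has (e d) m].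
Proof.
move=> P cC dC cd ws out /hasP[x xs ecx] /hasP[y ys edy].
have ss : all (mem s) s by apply/allP.
have [q [ips lq qs]] := connect_induced_path (B := mem s) xs (walk_connect ws ss xs ys).
have edx : ~~ e d x by apply: unique_attachment P (allP out x xs) cC dC cd ecx.
have [|p [x' [m [y' [r [E ecx' edy' mc md]]]]]] := trim_seq _ (e c) (e d) x q ecx edx.
  by rewrite lq.
exists x', m, y'; split=> //.
  apply: (induced_path_infix (p := p) (q := r)).
  by move: ips; rewrite E /= -?catA.
move=> z zm; apply: (allP qs); rewrite E mem_cat; apply/orP; right.
by move: zm; rewrite !(inE, mem_cat) => /or3P[]->; rewrite ?orbT.
Qed.

Lemma no_walk14 c1 c2 c3 c4 c5 s : pentagon C c1 c2 c3 c4 c5 ->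
  sorted e s -> all [predC C] s -> has (e c1) s -> has (e c4) s -> has (e c5) s.
Proof.
move=> P ws out h1 h4; apply/negPn/negP => f5.
have P4 := pentagon_rot (pentagon_rot (pentagon_rot P)).
have [C1 C4] := (pentagon_hd P, pentagon_hd P4).
have /andP[c41 _] := pentagon_far P4.
have [x [m [y [ips sub [e1x e4y] m1 m4]]]] :=
  induced_path_between P C1 C4 c41 ws out h1 h4.
apply: (no_induced_path14 P ips) => //.
  by apply/allP => z /sub; apply: (allP out).
have : ~~ has (e c5) (x :: m ++ [:: y]).
  by apply: contra f5 => /hasP[z /sub zs e5z]; apply/hasP; exists z.
by move=> f; split_along.
Qed.

(* The first time a walk has met neighbours of four of the c_i, it misses only
   one c_j, against no_walk14 for the two neighbours of c_j. *)
Lemma no_walk1234 c1 c2 c3 c4 c5 s : pentagon C c1 c2 c3 c4 c5 ->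
  sorted e s -> all [predC C] s ->
  has (e c1) s -> has (e c2) s -> has (e c3) s -> has (e c4) s -> False.
Proof.
elim: s c1 c2 c3 c4 c5 => // x s IH c1 c2 c3 c4 c5 P ws out h1 h2 h3 h4.
have h5 := no_walk14 P ws out h1 h4.
have {}ws : sorted e s by case: (s) ws => //= y t /andP[].
have [xC outs] : x \notin C /\ all [predC C] s by apply/andP.
(* All five [c_i] are met, and [x] accounts for at most one of them, so the tail still meets four
   consecutive ones. *)
have drop d1 d2 d3 d4 d5 : pentagon C d1 d2 d3 d4 d5 -> e d1 x ->
    has (e d2) (x :: s) -> has (e d3) (x :: s) -> has (e d4) (x :: s) ->
    has (e d5) (x :: s) -> False.
  move=> Q e1x; have Q2 := pentagon_rot Q.
  have Q3 := pentagon_rot Q2; have Q4 := pentagon_rot Q3; have Q5 := pentagon_rot Q4.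
  have D1 := pentagon_hd Q.
  have [/andP[d13 _] /andP[d41 _]] := (pentagon_far Q, pentagon_far Q4).
  have n2 : ~~ e d2 x.
    by apply: (unique_attachment Q xC D1 (pentagon_hd Q2) (edge_neq (pentagon_edge Q))).
  have n3 : ~~ e d3 x.
    by apply: (unique_attachment Q xC D1 (pentagon_hd Q3)) => //; rewrite eq_sym.
  have n4 : ~~ e d4 x by apply: (unique_attachment Q xC D1 (pentagon_hd Q4)).
  have n5 : ~~ e d5 x.
    apply: (unique_attachment Q xC D1 (pentagon_hd Q5)) => //.
    by rewrite eq_sym edge_neq // (pentagon_edge Q5).
  rewrite /= (negbTE n2) (negbTE n3) (negbTE n4) (negbTE n5) /=.
  exact: (IH _ _ _ _ _ Q2).
have P2 := pentagon_rot P; have P3 := pentagon_rot P2.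
have P4 := pentagon_rot P3.
have [e1x|n1] := boolP (e c1 x); first exact: (drop _ _ _ _ _ P).
have [e2x|n2] := boolP (e c2 x); first exact: (drop _ _ _ _ _ P2).
have [e3x|n3] := boolP (e c3 x); first exact: (drop _ _ _ _ _ P3).
have [e4x|n4] := boolP (e c4 x); first exact: (drop _ _ _ _ _ P4).
move: h1 h2 h3 h4; rewrite /= (negbTE n1) (negbTE n2) (negbTE n3) (negbTE n4) /=.
exact: (IH _ _ _ _ _ P).
Qed.

(** * Components outside a 5-cycle *)

Section Attachments.

Variable D : pred T.
Hypothesis D_out : {in D, forall v, v \notin C}.

(** A component of the subgraph induced on [D] is represented by any of its vertices [v]. *)
Definition attached c v : bool := [exists u, connect (restr D) v u && e c u].

Lemma attached_connect c v w : connect (restr D) v w -> attached c w -> attached c v.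
Proof.
move=> vw /existsP[u /andP[wu ecu]]; apply/existsP; exists u.
by rewrite ecu (connect_trans vw).
Qed.

Lemma all_out s : all D s -> all [predC C] s.
Proof. by move=> /allP Ds; apply/allP => v /Ds; apply: D_out. Qed.

Lemma connect_walk v w : D v -> connect (restr D) v w ->
  exists p, [/\ path e v p, all D p & last v p = w].
Proof. by move=> Dv /connectP[p /path_restr[ep Dp] ->]; exists p. Qed.

(** Each vertex of [s] is visited by an excursion from [v] and back. Repeated vertices are harmless,
    since [no_walk14] and [no_walk1234] are about walks. *)
Lemma walk_through v s : D v -> all (connect (restr D) v) s ->
  exists p, [/\ path e v p, all D p & {subset s <= v :: p}].
Proof.
move=> Dv; elim: s => [|u s IH]; first by exists [::].
move=> /= /andP[vu /IH[p [ep Dp sp]]].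
have [q [eq_ Dq lq]] := connect_walk Dv vu.
have Du : D u by apply: connect_restr_in vu.
have uv : connect (restr D) u v by rewrite connect_restr_sym.
have [r [er Dr lr]] := connect_walk Du uv.
exists (q ++ r ++ p); split.
- by rewrite !cat_path eq_ lq er lr.
- by rewrite !all_cat Dq Dr.
move=> z; rewrite inE => /predU1P[->|/sp].
  by rewrite -cat_cons mem_cat -lq mem_last.
by rewrite !inE !mem_cat => /predU1P[->|->]; rewrite ?eqxx ?orbT.
Qed.

Lemma attached_walk v cs : D v -> all (attached^~ v) cs ->
  exists s, [/\ sorted e s, all D s, {in s, forall u, connect (restr D) v u}
    & all (fun c => has (e c) s) cs].
Proof.
(* The default [v] is never taken for [c] in [cs], by [fP]. *)
move=> Dv acs; pose f c := odflt v [pick u | connect (restr D) v u && e c u].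
have fP c : c \in cs -> connect (restr D) v (f c) && e c (f c).
  move=> /(allP acs) /existsP[u hu]; rewrite /f; case: pickP => [//|/(_ u)].
  by rewrite hu.
have [|p [ep Dp sp]] := @walk_through v (map f cs) Dv.
  by apply/allP => _ /mapP[c /fP /andP[vc _] ->].
have Dvp : all D (v :: p) by rewrite /= Dv.
exists (v :: p); split=> //.
  by move=> u up; apply: (@walk_connect D (v :: p)); rewrite ?mem_head.
apply/allP => c cs_; apply/hasP; exists (f c); first by apply/sp/map_f.
by case/andP: (fP c cs_).
Qed.

Lemma attached_between c1 c2 c3 c4 c5 v : pentagon C c1 c2 c3 c4 c5 -> D v ->
  attached c1 v -> attached c4 v -> attached c5 v.
Proof.
move=> P Dv a1 a4; have [|s [ws Ds cs]] := @attached_walk v [:: c1; c4] Dv.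
  by rewrite /= a1 a4.
rewrite /= andbT => /andP[h1 h4].
have /hasP[u us e5u] := no_walk14 P ws (all_out Ds) h1 h4.
by apply/existsP; exists u; rewrite e5u cs.
Qed.

Lemma no_attached1234 c1 c2 c3 c4 c5 v : pentagon C c1 c2 c3 c4 c5 -> D v ->
  attached c1 v -> attached c2 v -> attached c3 v -> attached c4 v -> False.
Proof.
move=> P Dv a1 a2 a3 a4.
have [|s [ws Ds cs]] := @attached_walk v [:: c1; c2; c3; c4] Dv.
  by rewrite /= a1 a2 a3 a4.
rewrite /= andbT => /and4P[h1 h2 h3 h4].
exact: (no_walk1234 P ws (all_out Ds)).
Qed.

(** The component also attaches to [c2], which lies between; one more attachment would give four
    consecutive ones. *)
Lemma attached_two c1 c2 c3 c4 c5 v : pentagon C c1 c2 c3 c4 c5 -> D v ->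
  attached c1 v -> attached c3 v -> ~~ attached c4 v && ~~ attached c5 v.
Proof.
move=> P Dv a1 a3.
have a2 : attached c2 v.
  exact: (attached_between (pentagon_rot (pentagon_rot P)) Dv).
apply/andP; split; apply/negP => a.
  exact: (no_attached1234 P Dv).
by apply: (@no_attached1234 c5 c1 c2 c3 c4 v) => //; do 4!apply: pentagon_rot.
Qed.

Lemma attached_path c1 c2 c3 c4 c5 v : pentagon C c1 c2 c3 c4 c5 -> D v ->
  attached c1 v -> attached c3 v ->
  exists x m y, [/\ induced_path (x :: m ++ [:: y]), all D (x :: m ++ [:: y]),
    e c1 x /\ e c3 y, ~~ has (e c1) m /\ ~~ has (e c3) m
    & all (connect (restr D) v) (x :: m ++ [:: y])].
Proof.
move=> P Dv a1 a3.
have [C1 C3] := (pentagon_hd P, pentagon_hd (pentagon_rot (pentagon_rot P))).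
have /andP[c31 _] := pentagon_far P; rewrite eq_sym in c31.
have [|s [ws Ds cs]] := @attached_walk v [:: c1; c3] Dv; first by rewrite /= a1 a3.
rewrite /= andbT => /andP[h1 h3].
have [x [m [y [ips sub exy m1 m3]]]] :=
  induced_path_between P C1 C3 c31 ws (all_out Ds) h1 h3.
have Dm : all D (x :: m ++ [:: y]) by apply/allP => z /sub; apply: (allP Ds).
have vm : all (connect (restr D) v) (x :: m ++ [:: y]).
  by apply/allP => z /sub; apply: cs.
by exists x, m, y; split.
Qed.

Lemma unattached_free c v s : all (connect (restr D) v) s -> ~~ attached c v ->
  ~~ has (e c) s.
Proof.
move=> /allP vs; apply: contra => /hasP[u us ecu].
by apply/existsP; exists u; rewrite vs.
Qed.

(** The first component misses [c4] and [c5], the second [c1] and [c2], so [even_path13] makes both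
    interiors [m] and [m'] even. Joined at [c3] and closed by the edge [c5 c1], the paths form a
    hole of odd length [size m + size m' + 7]. *)
Lemma no_two_centers c1 c2 c3 c4 c5 v w : pentagon C c1 c2 c3 c4 c5 -> D v -> D w ->
  attached c1 v -> attached c3 v -> attached c3 w -> attached c5 w -> False.
Proof.
move=> P Dv Dw a1v a3v a3w a5w.
have P3 := pentagon_rot (pentagon_rot P); have F := pentagon_flip P.
have P5 := pentagon_rot (pentagon_rot P3).
have [C1 C3 C5] := And3 (pentagon_hd P) (pentagon_hd P3) (pentagon_hd P5).
have /andP[c31 _] := pentagon_far P; have f35 := pentagon_far P3.
have /andP[c53 _] := f35; have c51 := edge_neq (pentagon_edge P5).
have /andP[n4v n5v] := attached_two P Dv a1v a3v.
have /andP[n1w n2w] := attached_two P3 Dw a3w a5w.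
have nvw : ~~ connect (restr D) v w.
  by apply: contra n5v => vw; apply: attached_connect vw a5w.
have [x [m [y [ip DP [e1x e3y] [m1 m3] cP]]]] := attached_path P Dv a1v a3v.
have [x' [m' [y' [ip' DP' [e3x' e5y'] [m3' m5'] cP']]]] := attached_path P3 Dw a3w a5w.
have [out out'] := (all_out DP, all_out DP').
have f4 := unattached_free cP n4v; have f5 := unattached_free cP n5v.
have f1 := unattached_free cP' n1w; have f2 := unattached_free cP' n2w.
(* The two components differ because only the second attaches to [c5]; hence their vertices are
   distinct and nonadjacent. *)
have cross u z : u \in x :: m ++ [:: y] -> z \in x' :: m' ++ [:: y'] -> far u z.
  move=> uP zP; have vu := allP cP u uP; have wz := allP cP' z zP.
  have zw : connect (restr D) z w by rewrite connect_restr_sym.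
  apply/andP; split.
    by apply: contraNneq nvw => zu; rewrite zu in zw; apply: connect_trans zw.
  apply: contra nvw => euz; apply: connect_trans vu (connect_trans (connect1 _) zw).
  by apply/and3P; split=> //; [apply: (allP DP) | apply: (allP DP')].
have em : ~~ odd (size m) by apply: (even_path13 P ip) => //; split_along.
have em' : ~~ odd (size m') by apply: (even_path13 P3 ip') => //; split_along.
have [xC yC] : x \notin C /\ y \notin C by split_along.
have [xC' yC'] : x' \notin C /\ y' \notin C by split_along.
have x3 : ~~ e c3 x by rewrite (unique_attachment P xC C1) // eq_sym.
have y1 : ~~ e c1 y by rewrite (unique_attachment P yC C3).
have x5' : ~~ e c5 x' by rewrite (unique_attachment P xC' C3) // eq_sym.
have y3' : ~~ e c3 y' by rewrite (unique_attachment P yC' C5).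
suff : odd (size (m ++ y :: c3 :: x' :: m' ++ [:: y'])).
  rewrite size_cat /= size_cat addn1 !oddD /=; move: em em'.
  by do 2!case: (odd _).
have ipS : induced_path (c3 :: x' :: m' ++ [:: y'; c5]).
  by apply: induced_path_ends => //; split_along.
have catS : x' :: m' ++ [:: y'; c5] = (x' :: m' ++ [:: y']) ++ [:: c5].
  by rewrite /= -catA.
have farS z : z \in x :: m ++ [:: y] -> all (far z) (x' :: m' ++ [:: y'; c5]).
  move=> zP; rewrite catS all_cat; apply/andP; split.
    by apply/allP => u; apply: cross.
  rewrite /= andbT far_sym.
  by apply: (allP (far_outside C5 out _)).
apply: (odd_hole_through_edge F (x := x) (w := x)) => //.
- have -> : x :: (m ++ [:: y, c3, x' & m' ++ [:: y']]) ++ [:: c5] =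
      (x :: m) ++ y :: c3 :: x' :: m' ++ [:: y'; c5].
    by rewrite /= -catA /= -catA.
  rewrite induced_path_cat ip /=; apply/andP; split.
    apply/and3P; split=> //; first by rewrite e_sym.
    by apply: farS; rewrite inE mem_cat mem_seq1 eqxx !orbT.
  apply/allrelP => u z uP; rewrite inE => /predU1P[->|].
    by rewrite far_sym; apply: (allP (far_outside C3 _ _)) uP; split_along.
  by apply: (allP (farS u _)); rewrite -cat_cons mem_cat uP.
- have -> : m ++ y :: c3 :: x' :: m' ++ [:: y'] =
    (m ++ [:: y]) ++ c3 :: (x' :: m' ++ [:: y']) by rewrite -catA.
  rewrite all_cat all_consE (pentagon_far P) far_outside //=; try by split_along.
  by apply: (far_outside (s := x' :: m' ++ [:: y'])).
- by rewrite inE eqxx.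
Qed.

End Attachments.

End Pentagon.

(** * Minimal non-3-colorable sets *)

(** A boolean over finite functions, so that [ex_minset] can pick a minimal set violating it. *)
Definition three_colorable_on (A : {set T}) : bool :=
  [exists f : {ffun T -> 'I_3}, forall x in A, forall y in A, e x y ==> (f x != f y)].

Lemma three_colorable_onP (A : {set T}) :
  reflect (exists f : T -> 'I_3, {in A &, forall x y, e x y -> f x != f y})
    (three_colorable_on A).
Proof.
apply: (iffP existsP) => -[f fP].
  exists f => x y xA yA; apply/implyP.
  by move/forall_inP: fP => /(_ x xA) /forall_inP /(_ y yA).
exists (finfun f); apply/forall_inP => x xA; apply/forall_inP => y yA.
by rewrite !ffunE; apply/implyP/fP.
Qed.

(** An odd closed walk inside [A] would contain an odd induced cycle, hence a pentagon; so the
    subgraph on [A] is bipartite and two colours suffice. *)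
Lemma no_pentagon_three_colorable (A : {set T}) :
  (forall C c1 c2 c3 c4 c5, pentagon C c1 c2 c3 c4 c5 -> ~~ (C \subset A)) ->
  three_colorable_on A.
Proof.
move=> noP; pose r := restr (mem A).
have r_sym : symmetric r.
  by move=> x y; rewrite /r /restr /= e_sym; case: (x \in A); case: (y \in A).
have [s cs|f fP] := bipartite_of_no_odd_cycle r_sym; last first.
  apply/three_colorable_onP; exists (fun x => if f x then ord0 else ord_max).
  move=> x y xA yA exy; have := fP x y; rewrite /r /restr /= xA yA exy => /(_ isT).
  by case: (f x); case: (f y).
apply/negP => os.
have sA : {subset s <= A}.
  move=> x xs; have := next_cycle cs xs; rewrite /r /restr /=.
  by case/and3P.
have ce : cycle e s by apply: sub_cycle cs => x y /and3P[].
have [s' [ic os' sub]] := odd_closed_walk ce os.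
have := odd_induced_cycle_size ic os'.
case: ic => /andP[/andP[cs' us'] _] _.
case: s' cs' us' sub {os'} => [|c1 [|c2 [|c3 [|c4 [|c5 [|//]]]]]] // cs' us' sub _.
have /noP/negP[] : pentagon [set:: [:: c1; c2; c3; c4; c5]] c1 c2 c3 c4 c5.
  by apply/and3P.
by apply/subsetP => x; rewrite inE => /sub /sA.
Qed.

(** * Extending and gluing 3-colourings *)

Lemma third_color (a b : 'I_3) : exists k : 'I_3, (k != a) && (k != b).
Proof.
have : ~~ ([set: 'I_3] \subset [set a; b]).
  apply/negP => /subset_leq_card; rewrite cardsT card_ord cards2.
  by case: (a != b).
by case/subsetPn => k _; rewrite !inE negb_or; exists k.
Qed.

Lemma recolor (a b a' b' : 'I_3) : a != b -> a' != b' ->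
  exists g : 'I_3 -> 'I_3, [/\ injective g, g a = a' & g b = b'].
Proof.
(* The second transposition fixes [a'], since neither [p b] nor [b'] equals [a' = p a]. *)
move=> ab ab'; pose p := tperm a a'; pose q := tperm (p b) b'.
have pa : p a = a' by rewrite /p tpermL.
exists (q \o p); split=> /=.
- by move=> x y /perm_inj /perm_inj.
- by rewrite pa /q tpermD // 1?eq_sym // -pa (inj_eq perm_inj).
- by rewrite /q tpermL.
Qed.

Section Critical.

Variable A : {set T}.
Hypothesis A_not : ~~ three_colorable_on A.
Hypothesis A_min : forall B : {set T}, B \proper A -> three_colorable_on B.

Variable C : {set T}.
Hypothesis CA : C \subset A.

Definition outside : pred T := [pred v | (v \in A) && (v \notin C)].

Lemma outside_out : {in outside, forall v, v \notin C}.
Proof. by move=> v /andP[]. Qed.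

(** Otherwise [c1] has only [c2] and [c5] as neighbours in [A], and a colouring of [A :\ c1] extends
    by a third colour. *)
Lemma outside_neighbor c1 c2 c3 c4 c5 : pentagon C c1 c2 c3 c4 c5 ->
  exists2 v, outside v & e c1 v.
Proof.
move=> P; have c1A : c1 \in A by apply: (subsetP CA); apply: pentagon_hd P.
have [/existsP[v /andP[]]|/existsPn no] := boolP [exists v, outside v && e c1 v].
  by exists v.
have /A_min/three_colorable_onP[f fP] : A :\ c1 \proper A.
  by rewrite properD1.
have [k /andP[k2 k5]] := third_color (f c2) (f c5).
have nb y : y \in A -> e c1 y -> k != f y.
  move=> yA ecy; have := no y.
  rewrite /outside /= yA ecy andbT negbK (mem_pentagon P) !inE.
  have /andP[_ /negP n3] := pentagon_far P.
  have /andP[_ n4] := pentagon_far (pentagon_flip P).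
  case/or4P => [/eqP Ey|/eqP->//|/eqP Ey|/orP[]/eqP Ey]; subst y => //.
  - by rewrite e_irr in ecy.
  - by rewrite ecy in n4.
case/negP: A_not; apply/three_colorable_onP.
exists (fun x => if x == c1 then k else f x) => x y xA yA exy.
have [Ex|xc] := eqVneq x c1; have [Ey|yc] := eqVneq y c1; subst => //.
- by rewrite e_irr in exy.
- exact: nb.
- by rewrite eq_sym; apply: nb; rewrite // e_sym.
- by apply: fP; rewrite // !inE ?xc ?yc.
Qed.

(** Otherwise the component [K] of [v] meets the rest of [A] only at the ends of the edge [c1 c2].
    Colourings of [A :\: K] and of [K] with [c1, c2] exist by minimality and can be made to agree on
    that edge, then glued. *)
Lemma no_edge_cutset c1 c2 c3 c4 c5 v : pentagon C c1 c2 c3 c4 c5 -> outside v ->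
  [|| attached outside c3 v, attached outside c4 v | attached outside c5 v].
Proof.
move=> P Dv; apply/negPn/negP; rewrite !negb_or => /and3P[n3 n4 n5].
have P2 := pentagon_rot P; have P3 := pentagon_rot P2.
have [C1 C2 C3] := And3 (pentagon_hd P) (pentagon_hd P2) (pentagon_hd P3).
pose K := [set w | connect (restr outside) v w].
have KD w : w \in K -> outside w.
  by rewrite inE; apply: connect_restr_in.
have KA w : w \in K -> w \in A by move=> /KD /andP[].
have vK : v \in K by rewrite inE.
have vA : v \in A by apply: KA.
have /A_min/three_colorable_onP[f fP] : A :\: K \proper A.
  apply/properP; split; first exact: subsetDl.
  by exists v; rewrite // inE vK.
have c3K : c3 \notin K by apply/negP => /KD /andP[_]; rewrite C3.
have /A_min/three_colorable_onP[h hP] : K :|: [set c1; c2] \proper A.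
  apply/properP; split.
    apply/subsetP => w; rewrite !inE => /orP[vw|/orP[]/eqP->].
    - by apply: KA; rewrite inE.
    - exact: (subsetP CA).
    - exact: (subsetP CA).
  exists c3; first exact: (subsetP CA).
  have /andP[c31 _] := pentagon_far P.
  rewrite in_setU (negbTE c3K) in_set2 /= negb_or c31 /= eq_sym.
  by rewrite (edge_neq (pentagon_edge P2)).
have CK c : c \in C -> c \notin K.
  by move=> cC; apply/negP => /KD /andP[_]; rewrite cC.
(* Both colourings separate the ends of the edge [c1 c2], so a permutation of the colours matches
   them there. *)
have [g [g_inj g1 g2]] : exists g : 'I_3 -> 'I_3,
    [/\ injective g, g (h c1) = f c1 & g (h c2) = f c2].
  apply: recolor.
    by apply: hP; rewrite ?inE ?eqxx ?orbT // (pentagon_edge P).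
  by apply: fP; rewrite ?(pentagon_edge P) // in_setD CK //= (subsetP CA).
have across x y : x \in K -> y \in A -> y \notin K -> e x y -> g (h x) != f y.
  move=> xK yA yK exy.
  have Dx := KD x xK.
  have yC : y \in C.
    apply: contraNT yK => yC; rewrite inE in xK; rewrite inE.
    apply: connect_trans xK (connect1 _).
    by apply/and3P; split=> //; apply/andP.
  have ay : attached outside y v.
    by apply/existsP; exists x; rewrite e_sym exy andbT; rewrite inE in xK.
  have [Ey|Ey] : y = c1 \/ y = c2.
    move: yC ay; rewrite (mem_pentagon P) !inE.
    case/or4P => [/eqP->|/eqP->|/eqP->|/orP[]/eqP->]; first by left.
    - by right.
    - by rewrite (negbTE n3).
    - by rewrite (negbTE n4).
    - by rewrite (negbTE n5).
  - rewrite Ey -g1 (inj_eq g_inj); apply: hP; rewrite -?Ey //.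
      by rewrite in_setU xK.
    by rewrite Ey !inE eqxx orbT.
  - rewrite Ey -g2 (inj_eq g_inj); apply: hP; rewrite -?Ey //.
      by rewrite in_setU xK.
    by rewrite Ey !inE eqxx !orbT.
case/negP: A_not; apply/three_colorable_onP.
exists (fun x => if x \in K then g (h x) else f x) => x y xA yA exy.
have [xK|xK] := boolP (x \in K); have [yK|yK] := boolP (y \in K).
- by rewrite (inj_eq g_inj); apply: hP; rewrite // in_setU ?xK ?yK.
- exact: across.
- by rewrite eq_sym; apply: across; rewrite // e_sym.
- by apply: fP; rewrite // in_setD ?xK ?yK.
Qed.

(** Applied to [c] and [d] at distance two on [C]; the centre is then the vertex between them. *)
Definition center c d : bool :=
  [exists v, [&& outside v, attached outside c v & attached outside d v]].

(** Take the component of an outside neighbour of [c1]. It is not confined to the edge [c1 c2] nor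
    to [c1 c5], so it attaches to [c3], to [c4], or to both [c2] and [c5]. *)
Lemma center_near c1 c2 c3 c4 c5 : pentagon C c1 c2 c3 c4 c5 ->
  [|| center c5 c2, center c1 c3 | center c4 c1].
Proof.
move=> P; have [v Dv e1v] := outside_neighbor P.
have a1 : attached outside c1 v by apply/existsP; exists v; rewrite connect0.
have cent c d : attached outside c v -> attached outside d v -> center c d.
  by move=> ac ad; apply/existsP; exists v; rewrite Dv ac.
have /or3P[a|a|a5] := no_edge_cutset P Dv.
- by rewrite (cent c1 c3) ?orbT.
- by rewrite (cent c4 c1) ?orbT.
have /or3P[a|a|a] := no_edge_cutset (pentagon_flip P) Dv.
- by rewrite (cent c4 c1) ?orbT.
- by rewrite (cent c1 c3) ?orbT.
- by rewrite (cent c5 c2).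
Qed.

Lemma center_exclusive c1 c2 c3 c4 c5 : pentagon C c1 c2 c3 c4 c5 ->
  ~~ (center c1 c3 && center c3 c5).
Proof.
move=> P; apply/negP => /andP[/existsP[v /and3P[Dv a1 a3]]].
case/existsP => w /and3P[Dw b3 b5].
exact: (no_two_centers outside_out P Dv Dw a1 a3 b3 b5).
Qed.

(** By [center_exclusive] no two centres are at distance two, so they lie among two consecutive
    vertices; the vertex opposite to these is near no centre, against [center_near]. The final case
    analysis checks this on five booleans. *)
Lemma critical_no_pentagon c1 c2 c3 c4 c5 : ~~ pentagon C c1 c2 c3 c4 c5.
Proof.
apply/negP => P; have P2 := pentagon_rot P; have P3 := pentagon_rot P2.
have P4 := pentagon_rot P3; have P5 := pentagon_rot P4.
have := center_exclusive P; have := center_exclusive P2.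
have := center_exclusive P3; have := center_exclusive P4.
have := center_exclusive P5; have := center_near P; have := center_near P2.
have := center_near P3; have := center_near P4; have := center_near P5.
by case: (center c1 c3); case: (center c2 c4); case: (center c3 c5);
   case: (center c4 c1); case: (center c5 c2).
Qed.

End Critical.

Lemma three_colorable_all (A : {set T}) : three_colorable_on A.
Proof.
apply: contraT => nA.
have [B /minsetP[nB Bmin]] := ex_minset (P := fun B => ~~ three_colorable_on B)
  (ex_intro _ A nA).
case/negP: (nB); apply: no_pentagon_three_colorable => C c1 c2 c3 c4 c5 P.
apply/negP => CB.
suff Bcrit (B' : {set T}) : B' \proper B -> three_colorable_on B'.
  by case/negP: (critical_no_pentagon nB Bcrit CB c1 c2 c3 c4 c5).
move=> B'B; apply: contraT => nB'.
by have := proper_neq B'B; rewrite (Bmin B' nB' (proper_sub B'B)) eqxx.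
Qed.

End Graph.

Theorem theorem1p4 (T : finType) (e : rel T) (e_sym : symmetric e)
    (e_irr : irreflexive e) (G2 : family_G2 e)
    (no_shared : ~ two_5cycles_sharing_edge e) :
  colorable e 3.
Proof.
have /three_colorable_onP[f fP] :=
  three_colorable_all e_sym e_irr G2 no_shared [set: T].
by exists f => x y; apply: fP; rewrite inE.
Qed.
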